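(* For all integers $n,s\ge 1$, $\chi_{ltna}(C_{4n+2}\vee C_{2s+1})=5$.
   Context: All graphs are finite and simple. $C_k$ is the cycle on $k$ vertices. The join $G\vee H$ of (vertex-disjoint) graphs has $V(G\vee H)=V(G)\cup V(H)$ and $E(G\vee H)=E(G)\cup E(H)\cup\{uv\mid u\in V(G),v\in V(H)\}$. For a graph $G=(V,E)$ of order $p$ and size $q$ without isolated vertices, a bijection $f:V\cup E\to\{1,\dots,p+q\}$ is a local total neighborhood antimagic labeling of $G$ if the induced vertex coloring $f^+_{tn}(u)=\sum_{ux\in E}[f(ux)+f(x)]$ satisfies $f^+_{tn}(u)\ne f^+_{tn}(v)$ for every edge $uv\in E$. The number of distinct induced colors is $c_{tn}(f)$. The local total neighborhood antimagic chromatic number $\chi_{ltna}(G)$ is the minimum of $c_{tn}(f)$ over all local total neighborhood antimagic labelings $f$ of $G$; an assertion $\chi_{ltna}(G)=k$ includes the assertion that $G$ admits such a labeling. *)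

(* Defs.v *)
From mathcomp Require Import all_boot.

Set Implicit Arguments.
Unset Strict Implicit.
Unset Printing Implicit Defensive.

Record sgraph := SGraph {
  vertex :> finType;
  adj : rel vertex;
  adj_sym : symmetric adj;
  adj_irr : irreflexive adj }.

Definition edges (G : sgraph) : {set {set G}} :=
  [set e | [exists u : G, exists v : G, adj u v && (e == [set u; v])]].

Definition no_isolated (G : sgraph) : Prop :=
  forall u : G, exists v : G, adj u v.

(* This is the cycle on k vertices when k >= 3; for k < 3 it is the path on k
   vertices, since loops and multiple edges are excluded. *)
Definition cycle_adj (k : nat) : rel 'I_k :=
  fun i j => (i != j) && ((j == i.+1 %% k :> nat) || (i == j.+1 %% k :> nat)).

Lemma cycle_adj_sym k : symmetric (@cycle_adj k).
Proof. by move=> i j; rewrite /cycle_adj eq_sym orbC. Qed.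

Lemma cycle_adj_irr k : irreflexive (@cycle_adj k).
Proof. by move=> i; rewrite /cycle_adj eqxx. Qed.

Definition cycle_graph (k : nat) : sgraph :=
  SGraph (@cycle_adj_sym k) (@cycle_adj_irr k).

Definition join_adj (G H : sgraph) : rel (G + H)%type :=
  fun x y => match x, y with
             | inl u, inl v => adj u v
             | inr u, inr v => adj u v
             | _, _ => true
             end.

Lemma join_adj_sym G H : symmetric (@join_adj G H).
Proof. by move=> [u|u] [v|v] //=; rewrite adj_sym. Qed.

Lemma join_adj_irr G H : irreflexive (@join_adj G H).
Proof. by move=> [u|u] /=; rewrite adj_irr. Qed.

Definition join_graph (G H : sgraph) : sgraph :=
  SGraph (@join_adj_sym G H) (@join_adj_irr G H).

(* The disjoint union of V and E. Labelings are total functions on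
   G + {set G}; their values outside elements G are never used. *)
Definition elements (G : sgraph) : {set G + {set G}} :=
  [set z | match z with inl _ => true | inr e => e \in edges G end].

Definition total_labeling (G : sgraph) (f : G + {set G} -> nat) : Prop :=
  {in elements G &, injective f} /\
  (forall m : nat, 1 <= m <= #|G| + #|edges G| <->
                   exists2 z, z \in elements G & f z = m).

Definition tn_color (G : sgraph) (f : G + {set G} -> nat) (u : G) : nat :=
  \sum_(x : G | adj u x) (f (inr [set u; x]) + f (inl x)).

Definition ltna_labeling (G : sgraph) (f : G + {set G} -> nat) : Prop :=
  total_labeling f /\
  (forall u v : G, adj u v -> tn_color f u <> tn_color f v).

Definition c_tn (G : sgraph) (f : G + {set G} -> nat) : nat :=
  size (undup (codom (tn_color f))).

(* chi_ltna G = k. As chi_ltna is a minimum over a possibly empty set, it is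
   expressed as a relation, which also records that G has no isolated vertices and
   admits a labeling. *)
Definition chi_ltna_is (G : sgraph) (k : nat) : Prop :=
  [/\ no_isolated G,
      exists2 f, @ltna_labeling G f & c_tn f = k
    & forall f, @ltna_labeling G f -> k <= c_tn f].

(* Main.v *)
(* Write h = 2n+1, m = 2h, r = 2s+1 and let K - 1 be the number of labels. Each
   label l has a partner K - l. An edge from u_i to u_(i+1) gets the partner of the
   label of u_(i+1), and likewise around the odd cycle, so the cycle edges and the
   neighbouring cycle vertices contribute 2K + u_(i-1) - u_i to the color of u_i. On
   the odd cycle the labels v_0, ..., v_(r-1) are consecutive, so v_(j-1) - v_j is
   constant except at j = 0, which receives the third color.

   The m x r array of join edges splits into column 0 and s pairs of columns. The
   two entries of a row in a pair of columns are partners, so they do not affect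
   row comparisons; placing the smaller one by the sign pattern +--+ makes the two
   column sums differ by exactly 2. Column 0 consists of the m middle labels; the
   u_i form a zigzag on an interval, whose steps u_i - u_(i-1), shifted alternately
   by two constants, run over those middle labels, so the color of u_i depends only
   on the parity of i.

   It remains to separate the two cycles. With u low and v high this holds by size
   if s >= h; otherwise it holds after replacing every label by its partner. The
   lower bound is the chromatic number 2 + 3 of the join. *)

Require Import Defs.
From mathcomp Require Import all_boot.
From mathcomp Require Import zify.

Set Implicit Arguments.
Unset Strict Implicit.
Unset Printing Implicit Defensive.

(** * Labelings of an arbitrary graph and their complements *)

Lemma eq_set2 (T : finType) (u v x y : T) :
  [set u; v] = [set x; y] -> x = u /\ y = v \/ x = v /\ y = u.
Proof.
move=> E.
have := set21 x y; rewrite -E !inE; have := set22 x y; rewrite -E !inE.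
have := set21 u v; rewrite E !inE; have := set22 u v; rewrite E !inE.
by do 4!case/orP=> /eqP ?; subst; auto.
Qed.

(** The pick chooses one of the two orientations of [e], so the value is well determined only when
    [el] is symmetric on adjacent pairs. *)
Definition edge_label (G : sgraph) (el : G -> G -> nat) (e : {set G}) : nat :=
  if [pick p : G * G | adj p.1 p.2 && (e == [set p.1; p.2])] is Some p
  then el p.1 p.2 else 0.

Definition extend_label (G : sgraph) (vl : G -> nat) (el : G -> G -> nat)
    (z : G + {set G}) : nat :=
  match z with inl x => vl x | inr e => edge_label el e end.

Lemma edge_labelE (G : sgraph) (el : G -> G -> nat) (u v : G) :
  (forall x y, adj x y -> el x y = el y x) -> adj u v ->
  edge_label el [set u; v] = el u v.
Proof.
move=> el_sym uv; rewrite /edge_label; case: pickP => [[x y] /=|/(_ (u, v))].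
  by case/andP=> xy /eqP/eq_set2[[-> ->]|[-> ->]] //; rewrite el_sym // adj_sym.
by rewrite /= uv eqxx.
Qed.

Lemma tn_color_extend (G : sgraph) (vl : G -> nat) (el : G -> G -> nat) (u : G) :
  (forall x y, adj x y -> el x y = el y x) ->
  tn_color (extend_label vl el) u = \sum_(x | adj u x) (el u x + vl x).
Proof.
by move=> el_sym; apply: eq_bigr => x ux /=; rewrite edge_labelE.
Qed.

Lemma mem_edges (G : sgraph) (u v : G) : adj u v -> [set u; v] \in edges G.
Proof.
move=> uv; rewrite inE; apply/existsP; exists u; apply/existsP; exists v.
by rewrite uv eqxx.
Qed.

Lemma card_elements (G : sgraph) : #|elements G| = #|G| + #|edges G|.
Proof.
rewrite -sum1_card big_sumType /= -[#|G|]sum1_card -[#|edges G|]sum1_card.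
by congr (_ + _); apply: eq_bigl => x; rewrite !inE.
Qed.

(** A map from at most [N] elements that reaches [N] values is injective, and there are exactly [N]
    elements. Surjectivity and an upper bound on the number of elements thus suffice for a
    labeling. *)
Lemma total_labeling_onto (G : sgraph) (f : G + {set G} -> nat) (N : nat) :
  #|elements G| <= N ->
  (forall m, 1 <= m <= N -> exists2 z, z \in elements G & f z = m) ->
  total_labeling f /\ #|G| + #|edges G| = N.
Proof.
move=> leN onto; set s := [seq f z | z in elements G].
have sz : size s = #|elements G| by rewrite size_image.
have sub : {subset iota 1 N <= s}.
  move=> m; rewrite mem_iota add1n ltnS => /onto[z zE <-].
  exact: image_f.
have le_sz : size s <= size (iota 1 N) by rewrite size_iota sz.
have [eq_sz eq_mem] := uniq_min_size (iota_uniq 1 N) sub le_sz.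
have EN : #|G| + #|edges G| = N by rewrite -card_elements -sz -eq_sz size_iota.
split=> //; split.
  by apply/dinjectiveP; apply: leq_size_uniq (iota_uniq 1 N) sub le_sz.
move=> m; rewrite EN; split; first exact: onto.
case=> z zE <-; have: f z \in s by apply: image_f.
by rewrite -eq_mem mem_iota add1n ltnS.
Qed.

Lemma total_labeling_compl (G : sgraph) (f : G + {set G} -> nat) :
  total_labeling f ->
  total_labeling (fun z => (#|G| + #|edges G|).+1 - f z).
Proof.
set N := #|G| + #|edges G| => -[f_inj f_onto].
have f_range z : z \in elements G -> 1 <= f z <= N.
  by move=> zE; apply/f_onto; exists z.
split.
  move=> x y xE yE; have := f_range x xE; have := f_range y yE => hx hy hxy.
  by apply: f_inj => //; lia.
move=> m; split.
  move=> hm; have /f_onto[z zE hz] : 1 <= N.+1 - m <= N by lia.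
  by exists z => //; rewrite hz subKn //; lia.
by case=> z /f_range hz <-; lia.
Qed.

(** Each neighbor contributes one vertex label and one edge label, and each of these adds up with
    its partner to the number of labels plus one. *)
Lemma tn_color_compl (G : sgraph) (f : G + {set G} -> nat) (u : G) :
  total_labeling f ->
  tn_color f u + tn_color (fun z => (#|G| + #|edges G|).+1 - f z) u =
  2 * (#|G| + #|edges G|).+1 * #|[pred x | adj u x]|.
Proof.
move=> [_ f_onto]; rewrite /tn_color -big_split mulnC -sum_nat_const /=.
apply: eq_bigr => x ux.
have f_range z : z \in elements G -> 1 <= f z <= #|G| + #|edges G|.
  by move=> zE; apply/f_onto; exists z.
have he : 1 <= f (inr [set u; x]) <= #|G| + #|edges G|.
  by apply: f_range; rewrite inE; apply: mem_edges.
have hx : 1 <= f (inl x) <= #|G| + #|edges G| by apply: f_range; rewrite inE.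
by move: he hx; move: (#|G| + _) (f _) (f _) => N a b; lia.
Qed.

(** * Neighbors and oriented edges in a cycle *)

Section Cycle.
Variable k : nat.
Implicit Types i j : 'I_k.

Lemma val_ordS i : ordS i = (if i.+1 == k then 0 else i.+1) :> nat.
Proof.
case: eqP => /= [->|ne]; first by rewrite modnn.
by rewrite modn_small //; have := ltn_ord i; lia.
Qed.

Lemma val_ord_pred i : ord_pred i = (if i == 0 :> nat then k.-1 else i.-1) :> nat.
Proof.
have lt_ik := ltn_ord i; case: eqP => /= ne; first by rewrite modn_small; lia.
by rewrite (_ : (i + k).-1 = i.-1 + k) ?modnDr ?modn_small; lia.
Qed.

Hypothesis k_gt2 : 2 < k.

Lemma cycle_adjE i j : cycle_adj i j = (j == ordS i) || (j == ord_pred i).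
Proof.
have E : (j == ord_pred i) = (i == ordS j).
  by apply/eqP/eqP=> ->; rewrite ?ord_predK ?ordSK.
rewrite E /cycle_adj.
have -> : (j == i.+1 %% k :> nat) = (j == ordS i) by [].
have -> : (i == j.+1 %% k :> nat) = (i == ordS j) by [].
case: (i =P j) => // <-; rewrite orbb; apply/esym/eqP => /(congr1 (@nat_of_ord k)).
by rewrite val_ordS; have := ltn_ord i; case: ifP; lia.
Qed.

Lemma ordS_neq_pred i : (ordS i == ord_pred i) = false.
Proof.
apply/eqP => /(congr1 (@nat_of_ord k)); rewrite val_ordS val_ord_pred.
by have := ltn_ord i; do 2!case: ifP; lia.
Qed.

Lemma sum_cycle_adj i (F : 'I_k -> nat) :
  \sum_(j | cycle_adj i j) F j = F (ord_pred i) + F (ordS i).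
Proof.
rewrite (bigD1 (ordS i)) ?cycle_adjE ?eqxx //= (bigD1 (ord_pred i)) /=; last first.
  by rewrite cycle_adjE eqxx orbT eq_sym ordS_neq_pred.
rewrite big1 ?addn0 1?addnC // => j.
by rewrite cycle_adjE; case: (j == ordS i); case: (j == ord_pred i).
Qed.

(* The end of the edge ij that comes second in cyclic order. *)
Definition arc_head i j := if j == ordS i then j else i.

Lemma arc_head_ordS i : arc_head i (ordS i) = ordS i.
Proof. by rewrite /arc_head eqxx. Qed.

Lemma arc_head_pred i : arc_head i (ord_pred i) = i.
Proof. by rewrite /arc_head eq_sym ordS_neq_pred. Qed.

Lemma arc_head_sym i j : cycle_adj i j -> arc_head i j = arc_head j i.
Proof.
rewrite cycle_adjE => /orP[]/eqP->.
  by rewrite arc_head_ordS; have := arc_head_pred (ordS i); rewrite ordSK.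
by rewrite arc_head_pred; have := arc_head_ordS (ord_pred i); rewrite ord_predK.
Qed.

End Cycle.

(** * Sums over a join and the lower bound *)

Lemma sum_join_adj (G H : sgraph) (x : join_graph G H) (F : join_graph G H -> nat) :
  \sum_(y | adj x y) F y =
  match x with
  | inl u => \sum_(v : G | adj u v) F (inl v) + \sum_(w : H) F (inr w)
  | inr w => \sum_(v : G) F (inl v) + \sum_(w' : H | adj w w') F (inr w')
  end.
Proof. by case: x => x; rewrite big_sumType. Qed.

(** With two colors only, the color would depend on the parity of the index, so the adjacent
    vertices [2 * s] and [0] would agree. *)
Lemma odd_cycle_three_colors (s : nat) (c : 'I_(2 * s + 1) -> nat) : 1 <= s ->
  (forall i j, cycle_adj i j -> c i <> c j) ->
  exists i j l, uniq [:: c i; c j; c l].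
Proof.
move=> s_gt0 proper; have k_gt2 : 2 < 2 * s + 1 by lia.
have step (i : 'I_(2 * s + 1)) : c i <> c (ordS i).
  by apply: proper; rewrite cycle_adjE // eqxx.
have k_gt0 : 0 < 2 * s + 1 by lia.
pose z := Ordinal k_gt0; have z1 := step z.
case: (pickP (fun l => (c l != c z) && (c l != c (ordS z)))) => [l hl|no3].
  exists z, (ordS z), l; move: hl; rewrite /= !inE.
  case/andP=> lz lz'; rewrite negb_or andbT [c z == c l]eq_sym [c _ == c l]eq_sym.
  by rewrite lz lz' !andbT; apply/eqP.
have alt i (ik : i < 2 * s + 1) : c (Ordinal ik) = if odd i then c (ordS z) else c z.
  elim: i ik => [|i IH] ik; first by congr c; apply: val_inj.
  have ik' : i < 2 * s + 1 by lia.
  have := step (Ordinal ik'); rewrite IH.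
  have -> : ordS (Ordinal ik') = Ordinal ik.
    by apply: val_inj; rewrite /= modn_small.
  have /negbT := no3 (Ordinal ik); rewrite negb_and !negbK /=.
  by case: (odd i) => /= /orP[]/eqP-> //.
have lt2s : 2 * s < 2 * s + 1 by lia.
case: (step (Ordinal lt2s)); rewrite alt (_ : odd (2 * s) = false); last by lia.
by congr c; apply: val_inj; rewrite /= addn1 modnn.
Qed.

Lemma c_tn_join_cycles_ge5 (k s : nat) (f : _ -> nat) : 2 < k -> 1 <= s ->
  ltna_labeling (G := join_graph (cycle_graph k) (cycle_graph (2 * s + 1))) f ->
  5 <= c_tn f.
Proof.
move=> k_gt2 s_gt0 [_ proper].
have k_gt0 : 0 < k by lia.
pose a := Ordinal k_gt0; pose b := ordS a.
pose G := join_graph (cycle_graph k) (cycle_graph (2 * s + 1)).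
pose cl (i : 'I_k) := @tn_color G f (inl i).
pose cr (i : 'I_(2 * s + 1)) := @tn_color G f (inr i).
have [i [j [l uq]]] : exists i j l, uniq [:: cr i; cr j; cr l].
  by apply: odd_cycle_three_colors => // x y xy; apply: proper.
have ab : cl a <> cl b by apply: proper; rewrite /= cycle_adjE // eqxx.
have lr x y : cl x <> cr y by apply: proper.
have sub : {subset [:: cl a; cl b; cr i; cr j; cr l] <= undup (codom (tn_color f))}.
  have mem x : tn_color f x \in undup (codom (tn_color f)) by rewrite mem_undup codom_f.
  by apply/allP; rewrite /= !mem.
apply: leq_trans (uniq_leq_size _ sub) => //.
rewrite !cons_uniq -/(uniq [:: cr i; cr j; cr l]) uq andbT !inE.
by rewrite !negb_or; do 6?[apply/andP; split] => //; apply/eqP; auto.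
Qed.

(** * The label blocks: zigzag, middle column and paired columns *)

(* Half the number of labels. *)
Definition mid (n s : nat) : nat :=
  (2 * n + 1) * (2 * s + 1) + (4 * n + 2) + (2 * s + 1).

Definition compl_sum (n s : nat) : nat := (2 * mid n s).+1.

(** The lower half of the labels in increasing blocks: smaller entries of the paired columns, labels
    of the [u_i], partners of the labels of the [v_j], lower half of column 0. *)
Lemma mid_eq (n s : nat) :
  mid n s = s * (4 * n + 2) + (4 * n + 2) + (2 * s + 1) + (2 * n + 1).
Proof. by rewrite /mid; lia. Qed.

Definition zigzag (n i : nat) : nat :=
  if i %% 4 == 0 then 2 * (i %/ 4) else
  if i %% 4 == 1 then 2 * n + 1 + i %/ 4 else
  if i %% 4 == 2 then 2 * (i %/ 4) + 1 else 3 * n + 2 + i %/ 4.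

(** The values are solved from [zigzag_spoke]. The residues 1, 3, 0, 2 modulo 4, in this order, fill
    consecutive blocks of the interval from [H - 2 * n] to [H + 2 * n + 1]. *)
Definition spoke (n H i : nat) : nat :=
  if i %% 4 == 0 then H + 1 + i %/ 4 else
  if i %% 4 == 1 then H - n - i %/ 4 else
  if i %% 4 == 2 then H + n + 2 + i %/ 4 else H - i %/ 4.

Lemma ltn_zigzag (n i : nat) : i < 4 * n + 2 -> zigzag n i < 4 * n + 2.
Proof. by rewrite /zigzag; do 3?case: ifP; lia. Qed.

Lemma zigzag_onto (n x : nat) : x < 4 * n + 2 ->
  exists2 i, i < 4 * n + 2 & zigzag n i = x.
Proof.
move=> hx; have [lt_x|ge_x] := ltnP x (2 * n + 1).
  by exists (2 * x); [lia | rewrite /zigzag; do 3?case: ifP; lia].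
have [lt_x'|ge_x'] := ltnP x (3 * n + 2).
  exists (4 * (x - (2 * n + 1)) + 1); first lia.
  by rewrite /zigzag; do 3?case: ifP; lia.
exists (4 * (x - (3 * n + 2)) + 3); first lia.
by rewrite /zigzag; do 3?case: ifP; lia.
Qed.

Lemma spoke_onto (n H m : nat) : 2 * n < H -> H - 2 * n <= m <= H + 2 * n + 1 ->
  exists2 i, i < 4 * n + 2 & spoke n H i = m.
Proof.
move=> hH hm; have [lt1|ge1] := leqP m (H - n).
  exists (4 * (H - n - m) + 1); first lia.
  by rewrite /spoke; do 3?case: ifP; lia.
have [lt2|ge2] := leqP m H.
  exists (4 * (H - m) + 3); first lia.
  by rewrite /spoke; do 3?case: ifP; lia.
have [lt3|ge3] := leqP m (H + n + 1).
  exists (4 * (m - H - 1)); first lia.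
  by rewrite /spoke; do 3?case: ifP; lia.
exists (4 * (m - H - n - 2) + 2); first lia.
by rewrite /spoke; do 3?case: ifP; lia.
Qed.

Lemma zigzag_spoke (n H i : nat) : 3 * n < H -> i < 4 * n + 2 ->
  zigzag n (if i == 0 then 4 * n + 1 else i.-1) + spoke n H i =
  zigzag n i + (if odd i then H - 3 * n - 1 else H + 3 * n + 2).
Proof.
move=> hH hi; case: (i =P 0) => [->|i0].
  (* The step that closes the cycle, from the last index back to 0, obeys the same rule. *)
  have -> : zigzag n (4 * n + 1) = 3 * n + 1.
    by rewrite /zigzag; do 3?case: ifP; lia.
  by rewrite /zigzag /spoke /=; lia.
by rewrite /zigzag /spoke; do 7?case: ifP; lia.
Qed.

Lemma sum_spoke (n H : nat) : 2 * n < H ->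
  \sum_(i < 4 * n + 2) spoke n H i = (2 * n + 1) * (2 * H).+1.
Proof.
move=> hH.
(* The induction is on the number of rows, as [n] also occurs inside [spoke]. The first two entries
   fall short of [(2 * H).+1] by [n]; each further block of four adds [4 * H + 3]. *)
suff sum_part q : q <= n ->
    \sum_(i < 4 * q + 2) spoke n H i + n = q * (4 * H + 3) + (2 * H).+1.
  by have := sum_part n (leqnn n); nia.
elim: q => [|q IH] lt_qn.
  by rewrite !big_ord_recr big_ord0 /spoke /=; lia.
rewrite (_ : 4 * q.+1 + 2 = (4 * q + 2).+4); last by lia.
rewrite !big_ord_recr /=; have := IH (ltnW lt_qn).
have -> : spoke n H (4 * q + 2) = H + n + 2 + q.
  by rewrite /spoke; do 3?case: ifP; lia.
have -> : spoke n H (4 * q + 2).+1 = H - q.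
  by rewrite /spoke; do 3?case: ifP; lia.
have -> : spoke n H (4 * q + 2).+2 = H + 2 + q.
  by rewrite /spoke; do 3?case: ifP; lia.
have -> : spoke n H (4 * q + 2).+3 = H - n - q.+1.
  by rewrite /spoke; do 3?case: ifP; lia.
by move: (\sum_(i < _) _) => S; rewrite mulSn; lia.
Qed.

Definition low (i : nat) : bool := (i %% 4 == 0) || (i %% 4 == 3).

(** Rows 0 and 1 add up to [K - 1] or [K + 1], according to [b]. In each later block of four rows
    the offsets cancel, since 3 - 4 - 5 + 6 = 0, which leaves [2 * K]. *)
Lemma sum_signed (b : bool) (n K c : nat) : c + 4 * n + 2 <= K ->
  \sum_(i < 4 * n + 2) (if low i == b then c + i + 1 else K - (c + i + 1)) + b
  = (2 * n + 1) * K + ~~ b.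
Proof.
elim: n => [|n IH] hK.
  by rewrite !big_ord_recr big_ord0 /=; case: b => /=; lia.
rewrite (_ : 4 * n.+1 + 2 = (4 * n + 2).+4); last by lia.
rewrite !big_ord_recr /=; have {IH} := IH _.
have -> : low (4 * n + 2) = false by rewrite /low; lia.
have -> : low (4 * n + 2).+1 = true by rewrite /low; lia.
have -> : low (4 * n + 2).+2 = true by rewrite /low; lia.
have -> : low (4 * n + 2).+3 = false by rewrite /low; lia.
by case: b => /= IH; have := IH ltac:(lia); nia.
Qed.

(* The label of u_i v_j; for t >= 0 the columns 2t + 1 and 2t + 2 form a pair. *)
Definition cross (n s i j : nat) : nat :=
  if j == 0 then spoke n (mid n s) i else
  let l := j.-1 %/ 2 * (4 * n + 2) + i + 1 in
  if low i == odd j then l else compl_sum n s - l.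

Lemma cross_row_sum (n s i : nat) : i < 4 * n + 2 ->
  \sum_(j < 2 * s + 1) cross n s i j = spoke n (mid n s) i + s * compl_sum n s.
Proof.
move=> hi.
suff sum_part t : t <= s ->
    \sum_(j < 2 * t + 1) cross n s i j = spoke n (mid n s) i + t * compl_sum n s.
  exact: sum_part.
elim: t => [|t IH] lt_ts; first by rewrite big_ord1 mul0n addn0.
rewrite (_ : 2 * t.+1 + 1 = (2 * t + 1).+2); last by lia.
rewrite !big_ord_recr /= IH 1?ltnW // /cross !addn1 /=.
have -> : (2 * t) %/ 2 = t by lia.
have -> : (2 * t).+1 %/ 2 = t by lia.
have -> : odd (2 * t) = false by lia.
(* Makes the truncated subtraction from [compl_sum n s] exact. *)
have lt_top : t * (4 * n + 2) + i < compl_sum n s.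
  rewrite /compl_sum mid_eq.
  by have : t * (4 * n + 2) <= s * (4 * n + 2); [rewrite leq_mul2r ltnW ?orbT | lia].
by case: (low i) => /=; lia.
Qed.

Lemma cross_col_sum (n s j : nat) : j < 2 * s + 1 ->
  \sum_(i < 4 * n + 2) cross n s i j + (odd j) =
  (2 * n + 1) * compl_sum n s + ((j != 0) && ~~ odd j).
Proof.
rewrite /cross; case: (j =P 0) => [->|j0] hj /=.
  rewrite sum_spoke /compl_sum ?addn0 //.
  by rewrite mid_eq; lia.
rewrite sum_signed // /compl_sum.
rewrite mid_eq.
have : j.-1 %/ 2 * (4 * n + 2) <= s * (4 * n + 2) by rewrite leq_mul2r; lia.
by lia.
Qed.

Definition ulabel (n s i : nat) : nat := s * (4 * n + 2) + 1 + zigzag n i.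
Definition vlabel (n s j : nat) : nat := mid n s + 2 * n + 2 + j.

Lemma ulabel_bound (n s i : nat) : i < 4 * n + 2 -> ulabel n s i <= mid n s.
Proof.
by move=> /ltn_zigzag; rewrite /ulabel mid_eq; lia.
Qed.

(** The middle interval is closed under partners and is column 0. Any other [m] is replaced by the
    smaller label [l] of its pair, which is located in the blocks of [mid_eq]. *)
Lemma label_onto (n s m : nat) : 1 <= m < compl_sum n s ->
  [\/ exists2 i, i < 4 * n + 2 & ulabel n s i = m \/ compl_sum n s - ulabel n s i = m,
      exists2 j, j < 2 * s + 1 & vlabel n s j = m \/ compl_sum n s - vlabel n s j = m
    | exists i j, [/\ i < 4 * n + 2, j < 2 * s + 1 & cross n s i j = m] ].
Proof.
move=> hm; have hH := mid_eq n s.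
have [in_spoke|out_spoke] := boolP (mid n s - 2 * n <= m <= mid n s + 2 * n + 1).
  constructor 3; have [|i hi <-] := spoke_onto _ in_spoke; first by lia.
  by exists i, 0; split=> //; lia.
pose l := if m <= mid n s then m else compl_sum n s - m.
have lm : l = m \/ compl_sum n s - l = m by rewrite /l; case: ifP; lia.
have hl : 1 <= l < mid n s - 2 * n.
  by rewrite /l; move: hm; rewrite /compl_sum; case: ifP; lia.
have [le1|gt1] := leqP l (s * (4 * n + 2)).
  constructor 3; pose t := l.-1 %/ (4 * n + 2); pose i := l.-1 %% (4 * n + 2).
  have hi : i < 4 * n + 2 by rewrite ltn_mod; lia.
  have El : l = t * (4 * n + 2) + i + 1 by rewrite /t /i -divn_eq; lia.
  have ht : t < s by rewrite /t ltn_divLR; lia.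
  (* Row [i] has [l] in one column of pair [t] and the partner of [l] in the other; this test tells
     which column holds [m]. *)
  have [b_l|b_l] := boolP (low i (+) (m == l)).
    exists i, (2 * t + 2); split=> //; first lia.
    rewrite /cross (_ : (2 * t + 2).-1 %/ 2 = t); last lia.
    rewrite (_ : odd (2 * t + 2) = false) -?El; last lia.
    rewrite (_ : (_ == 0) = false); last lia.
    by move: b_l; case: (low i) => /=; case: eqP; case: lm; lia.
  exists i, (2 * t + 1); split=> //; first lia.
  rewrite /cross (_ : (2 * t + 1).-1 %/ 2 = t); last lia.
  rewrite (_ : odd (2 * t + 1) = true) -?El; last lia.
  rewrite (_ : (_ == 0) = false); last lia.
  by move: b_l; case: (low i) => /=; case: eqP; case: lm; lia.
have [le2|gt2] := leqP l (s * (4 * n + 2) + (4 * n + 2)).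
  constructor 1; have [|i hi Ei] := @zigzag_onto n (l - s * (4 * n + 2) - 1).
    by lia.
  by exists i => //; rewrite /ulabel Ei; case: lm; lia.
constructor 2; exists (mid n s - 2 * n - 1 - l); first lia.
by rewrite /vlabel; move: lm; rewrite /compl_sum; lia.
Qed.

(** * The labeling of the join and its induced colors *)

Definition joinC (n s : nat) : sgraph :=
  join_graph (cycle_graph (4 * n + 2)) (cycle_graph (2 * s + 1)).

Definition vertex_label (n s : nat) (x : joinC n s) : nat :=
  match x with inl i => ulabel n s i | inr j => vlabel n s j end.

Definition arc_label (n s : nat) (x y : joinC n s) : nat :=
  match x, y with
  | inl i, inl i' => compl_sum n s - ulabel n s (arc_head i i')
  | inr j, inr j' => compl_sum n s - vlabel n s (arc_head j j')
  | inl i, inr j | inr j, inl i => cross n s i j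
  end.

Definition labeling (n s : nat) : joinC n s + {set joinC n s} -> nat :=
  extend_label (@vertex_label n s) (@arc_label n s).

Definition usum (n s : nat) : nat := \sum_(i < 4 * n + 2) ulabel n s i.
Definition vsum (n s : nat) : nat := \sum_(j < 2 * s + 1) vlabel n s j.

(* [b] is the parity of the index on the even cycle; in [vcolor], [None] is the
   vertex v_0 and [Some b] the other vertices of index parity [b]. *)
Definition ucolor (n s : nat) (b : bool) : nat :=
  s.+2 * compl_sum n s + vsum n s +
  (if b then mid n s - 3 * n - 1 else mid n s + 3 * n + 2).

Definition vclass (j : nat) : option bool := if j == 0 then None else Some (odd j).

Definition vcolor (n s : nat) (o : option bool) : nat :=
  (2 * n + 3) * compl_sum n s + usum n s +
  (if o is None then 2 * s else 0) - (if o == Some true then 2 else 0).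

Lemma vlabel_bound (n s j : nat) : j < 2 * s + 1 -> vlabel n s j < compl_sum n s.
Proof.
by rewrite /vlabel /compl_sum mid_eq; lia.
Qed.

Lemma usum_bound (n s : nat) : usum n s <= (4 * n + 2) * mid n s.
Proof.
rewrite -[4 * n + 2 in X in _ <= X]card_ord -sum_nat_const.
by apply: leq_sum => i _; apply: ulabel_bound.
Qed.

Lemma vsum_bound (n s : nat) : (2 * s + 1) * (mid n s).+1 <= vsum n s.
Proof.
rewrite -[2 * s + 1 in X in X <= _]card_ord -sum_nat_const.
by apply: leq_sum => j _; rewrite /vlabel; lia.
Qed.

Section Labeling.
Variables n s : nat.
Hypotheses (n_gt0 : 0 < n) (s_gt0 : 0 < s).

Let m_gt2 : 2 < 4 * n + 2. Proof. by lia. Qed.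
Let r_gt2 : 2 < 2 * s + 1. Proof. by lia. Qed.

Lemma arc_label_sym (x y : joinC n s) : adj x y -> arc_label x y = arc_label y x.
Proof.
by case: x y => [i|j] [i'|j'] //= /arc_head_sym->.
Qed.

Lemma tn_color_u (i : 'I_(4 * n + 2)) :
  tn_color (@labeling n s) (inl i) = ucolor n s (odd i).
Proof.
rewrite tn_color_extend; last exact: arc_label_sym.
rewrite sum_join_adj /= sum_cycle_adj // arc_head_pred // arc_head_ordS big_split /=.
rewrite cross_row_sum // -/(vsum n s).
have hH : 3 * n < mid n s by rewrite mid_eq; lia.
have step := zigzag_spoke hH (ltn_ord i).
have hp : ord_pred i = (if i == 0 :> nat then 4 * n + 1 else i.-1) :> nat.
  by rewrite val_ord_pred; case: ifP; lia.
have hi := ulabel_bound s (ltn_ord i).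
have hS := ulabel_bound s (ltn_ord (ordS i)).
rewrite /ucolor; rewrite -hp in step; move: step hi hS.
rewrite /ulabel.
move: (zigzag _ _) (zigzag _ _) (zigzag _ _) (spoke _ _ _).
move: (vsum n s) (if _ then _ else _).
rewrite /compl_sum; move: (mid n s) (s * (4 * n + 2)) => H M V b z1 z2 z3 w *; lia.
Qed.

Lemma tn_color_v (j : 'I_(2 * s + 1)) :
  tn_color (@labeling n s) (inr j) = vcolor n s (vclass j).
Proof.
rewrite tn_color_extend; last exact: arc_label_sym.
rewrite sum_join_adj /= sum_cycle_adj // arc_head_pred // arc_head_ordS big_split /=.
rewrite -/(usum n s) /vcolor /vclass.
have := cross_col_sum n (ltn_ord j); move: (\sum_(i < _) cross _ _ _ _) => S.
have hj := vlabel_bound n (ltn_ord j).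
have hS := vlabel_bound n (ltn_ord (ordS j)).
(* The previous label minus the own one is [2 * s] at index 0 and -1 elsewhere. The column sums add
   -1 at odd indices and 1 at positive even ones, whence the offsets [2 * s], -2 and 0 in
   [vcolor]. *)
have hjp : vlabel n s j + (if j == 0 :> nat then 2 * s + 1 else 0) =
    (vlabel n s (ord_pred j)).+1.
  by rewrite /vlabel val_ord_pred; case: ifP; lia.
move: hj hS hjp; move: (vlabel _ _ _) (vlabel _ _ _) (vlabel _ _ _).
move: (usum n s) (compl_sum n s).
move: (nat_of_ord j) => {}j U K a b c.
by case: (j =P 0) => [->|j0] /=; case: (odd j) => /=; nia.
Qed.

(** It suffices to cover all elements by a map [g] from a type of the right size. *)
Lemma card_elements_joinC : #|elements (joinC n s)| <= 2 * mid n s.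
Proof.
pose T : finType := ('I_(4 * n + 2) + 'I_(2 * s + 1) +
  ('I_(4 * n + 2) + 'I_(2 * s + 1) + 'I_(4 * n + 2) * 'I_(2 * s + 1)))%type.
pose g (t : T) : joinC n s + {set joinC n s} :=
  match t with
  | inl x => inl x
  | inr (inl (inl i)) => inr [set inl i; inl (ordS i)]
  | inr (inl (inr j)) => inr [set inr j; inr (ordS j)]
  | inr (inr (i, j)) => inr [set inl i; inr j]
  end.
have -> : 2 * mid n s = #|T|.
  by rewrite !card_sum card_prod !card_ord /mid; lia.
apply: leq_trans (leq_image_card g T); apply: subset_leq_card.
apply/subsetP => -[x _|e]; first exact: (codom_f g (inl x)).
rewrite inE inE => /existsP[x /existsP[y /andP[xy /eqP->]]].
case: x y xy => [i|j] [i'|j'] /=.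
- rewrite cycle_adjE // => /orP[]/eqP->; first exact: (codom_f g (inr (inl (inl i)))).
  by have := codom_f g (inr (inl (inl (ord_pred i)))); rewrite /= ord_predK setUC.
- by move=> _; apply: (codom_f g (inr (inr (i, j')))).
- by move=> _; have := codom_f g (inr (inr (i', j))); rewrite /= setUC.
rewrite cycle_adjE // => /orP[]/eqP->; first exact: (codom_f g (inr (inl (inr j)))).
by have := codom_f g (inr (inl (inr (ord_pred j)))); rewrite /= ord_predK setUC.
Qed.

Lemma labeling_total :
  total_labeling (@labeling n s) /\
  #|joinC n s| + #|edges (joinC n s)| = 2 * mid n s.
Proof.
have lab_edge (x y : joinC n s) : adj x y ->
    inr [set x; y] \in elements (joinC n s) /\
    labeling (inr [set x; y]) = arc_label x y.
  move=> xy; rewrite inE mem_edges //; split=> //.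
  by rewrite /labeling /extend_label edge_labelE //; apply: arc_label_sym.
apply: total_labeling_onto; first exact: card_elements_joinC.
move=> m hm; have /label_onto : 1 <= m < compl_sum n s by [].
case=> [[i hi [E|E]]|[j hj [E|E]]|[i [j [hi hj E]]]].
- by exists (inl (inl (Ordinal hi))); rewrite ?inE.
(* The partner of a vertex label lies on the edge coming from the preceding vertex. *)
- have [|zE zl] := lab_edge (inl (ord_pred (Ordinal hi))) (inl (Ordinal hi)).
    by rewrite /= cycle_adjE // ord_predK eqxx.
  exists (inr [set inl (ord_pred (Ordinal hi)); inl (Ordinal hi)]) => //.
  rewrite zl /=; have := arc_head_ordS (ord_pred (Ordinal hi)).
  by rewrite ord_predK => ->.
- by exists (inl (inr (Ordinal hj))); rewrite ?inE.
- have [|zE zl] := lab_edge (inr (ord_pred (Ordinal hj))) (inr (Ordinal hj)).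
    by rewrite /= cycle_adjE // ord_predK eqxx.
  exists (inr [set inr (ord_pred (Ordinal hj)); inr (Ordinal hj)]) => //.
  rewrite zl /=; have := arc_head_ordS (ord_pred (Ordinal hj)).
  by rewrite ord_predK => ->.
have [//|zE zl] := lab_edge (inl (Ordinal hi)) (inr (Ordinal hj)).
by exists (inr [set inl (Ordinal hi); inr (Ordinal hj)]); rewrite ?zl.
Qed.

Lemma deg_joinC (x : joinC n s) :
  #|[pred y | adj x y]| = if x is inl _ then 2 * s + 3 else 4 * n + 4.
Proof.
rewrite -sum1_card sum_join_adj.
by case: x => x; rewrite sum_cycle_adj // sum_nat_const card_ord; lia.
Qed.

(** A label pair averages [compl_sum n s] per neighbor. The labels of the [v_j] are above [mid n s],
    so up to a small error the color is at least the degree [2 * s + 3] times this average. *)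
Lemma ucolor_ge (b : bool) :
  (2 * s + 3) * compl_sum n s + s <= ucolor n s b + 3 * n + 1.
Proof.
have := vsum_bound n s; have : 3 * n < mid n s by rewrite mid_eq; lia.
rewrite /ucolor /compl_sum; case: b; nia.
Qed.

Lemma vcolor_le (o : option bool) :
  vcolor n s o + 2 * n + 1 <= (4 * n + 4) * compl_sum n s + 2 * s.
Proof.
have := usum_bound n s; rewrite /vcolor /compl_sum.
by case: o => [[]|] /=; nia.
Qed.

Lemma ucolor_gt_vcolor (b : bool) (o : option bool) :
  2 * n < s -> vcolor n s o < ucolor n s b.
Proof.
move=> lt_ns; have := ucolor_ge b; have := vcolor_le o.
have : (4 * n + 5) * compl_sum n s <= (2 * s + 3) * compl_sum n s.
  by rewrite leq_mul2r; lia.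
by have : 3 * n + s < compl_sum n s; [rewrite /compl_sum mid_eq | ]; lia.
Qed.

(** Complementing turns a color into [2 * compl_sum n s] times the degree minus that color. Written
    without subtraction, this puts the complemented colors of the [u_i] below those of the [v_j]. *)
Lemma ucolor_lt_vcolor_compl (b : bool) (o : option bool) : s <= 2 * n ->
  2 * compl_sum n s * (2 * s + 3) + vcolor n s o <
  2 * compl_sum n s * (4 * n + 4) + ucolor n s b.
Proof.
move=> le_sn; have := ucolor_ge b; have := vcolor_le o.
have : (2 * s + 4) * compl_sum n s <= (4 * n + 4) * compl_sum n s.
  by rewrite leq_mul2r; lia.
by have : 3 * n + s < compl_sum n s; [rewrite /compl_sum mid_eq | ]; lia.
Qed.

Lemma ucolor_inj : injective (ucolor n s).
Proof.
have hH := mid_eq n s.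
by move=> [] [] //; rewrite /ucolor; lia.
Qed.

Lemma vcolor_inj : injective (vcolor n s).
Proof.
(* Ensures that the truncated subtraction of 2 in [vcolor] is exact. *)
have hK : 2 < (2 * n + 3) * compl_sum n s.
  by have hH := mid_eq n s; rewrite /compl_sum; lia.
by move=> [[]|] [[]|] //; rewrite /vcolor /=; lia.
Qed.

End Labeling.

(** * Properness and the count of five colors *)

Lemma vclass_eq (a b : nat) : vclass a = vclass b ->
  (a == 0) = (b == 0) /\ (a = 0 \/ odd a = odd b).
Proof.
rewrite /vclass; case: (a =P 0) => [->|_]; case: (b =P 0) => [_|_] //; last case=> ->.
all: by auto.
Qed.

(** Serves both the labeling and its complement: the classes allow at most five colors, and the
    lower bound gives equality. *)
Lemma ltna_of_classes (n s : nat) (f : joinC n s + {set joinC n s} -> nat)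
    (cu : bool -> nat) (cv : option bool -> nat) : 0 < n -> 0 < s ->
  total_labeling f ->
  (forall i : 'I_(4 * n + 2), tn_color f (inl i) = cu (odd i)) ->
  (forall j : 'I_(2 * s + 1), tn_color f (inr j) = cv (vclass j)) ->
  injective cu -> injective cv -> (forall b o, cu b <> cv o) ->
  ltna_labeling f /\ c_tn f = 5.
Proof.
move=> n_gt0 s_gt0 f_tot fu fv cu_inj cv_inj cu_cv.
have m_gt2 : 2 < 4 * n + 2 by lia.
have r_gt2 : 2 < 2 * s + 1 by lia.
have f_ltna : ltna_labeling f.
  split=> // -[i|j] [i'|j'] /= adj_xy; rewrite ?fu ?fv //.
  - move/cu_inj; move: adj_xy; rewrite cycle_adjE // => /orP[]/eqP->;
      rewrite ?val_ordS ?val_ord_pred; case: ifP; have := ltn_ord i; lia.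
  - exact/nesym/cu_cv.
  (* Only the edge between [2 * s] and 0 joins indices of equal parity, and there exactly one index
     is 0. *)
  - move=> /cv_inj/vclass_eq; move: adj_xy; rewrite cycle_adjE // => /orP[]/eqP->;
      rewrite ?val_ordS ?val_ord_pred; case: ifP; have := ltn_ord j; lia.
split=> //; apply/eqP; rewrite eqn_leq (c_tn_join_cycles_ge5 _ _ f_ltna) // andbT.
pose l := [:: cu true; cu false; cv None; cv (Some true); cv (Some false)].
rewrite -[5]/(size l); apply: uniq_leq_size; first exact: undup_uniq.
move=> c; rewrite mem_undup => /codomP[[x|x] ->]; rewrite ?fu ?fv !inE.
  by case: (odd x); rewrite eqxx ?orbT.
by case: (vclass x) => [[]|]; rewrite eqxx ?orbT.
Qed.

Lemma exists_labeling_five (n s : nat) : 0 < n -> 0 < s ->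
  exists2 f, @ltna_labeling (joinC n s) f & c_tn f = 5.
Proof.
move=> n_gt0 s_gt0; have [f_tot cardE] := labeling_total n_gt0 s_gt0.
have u_inj := ucolor_inj (s := s) n_gt0 s_gt0.
have v_inj := vcolor_inj n_gt0 s_gt0.
have fu := tn_color_u n_gt0 s_gt0; have fv := tn_color_v n_gt0 s_gt0.
have [le_sn|lt_ns] := leqP s (2 * n); last first.
  have uv b o : ucolor n s b <> vcolor n s o.
    by have := ucolor_gt_vcolor n_gt0 s_gt0 b o lt_ns; lia.
  have [] := ltna_of_classes n_gt0 s_gt0 f_tot fu fv u_inj v_inj uv.
  by exists (@labeling n s).
pose g z := (#|joinC n s| + #|edges (joinC n s)|).+1 - @labeling n s z.
have gE (x : joinC n s) : tn_color (@labeling n s) x + tn_color g x =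
    2 * compl_sum n s * (if x is inl _ then 2 * s + 3 else 4 * n + 4).
  by rewrite (tn_color_compl x f_tot) deg_joinC // cardE.
have gu (i : 'I_(4 * n + 2)) :
    ucolor n s (odd i) + tn_color g (inl i) = 2 * compl_sum n s * (2 * s + 3).
  by rewrite -fu gE.
have gv (j : 'I_(2 * s + 1)) :
    vcolor n s (vclass j) + tn_color g (inr j) = 2 * compl_sum n s * (4 * n + 4).
  by rewrite -fv gE.
(* Every class occurs at some vertex, where the color and its complement add up to the bound. This
   makes the subtractions in [cu] and [cv] invertible. *)
have u_le b : ucolor n s b <= 2 * compl_sum n s * (2 * s + 3).
  have hb : b < 4 * n + 2 by case: b; lia.
  by rewrite -(gu (Ordinal hb)) /= oddb leq_addr.
have v_le o : vcolor n s o <= 2 * compl_sum n s * (4 * n + 4).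
  have [j hj <-] : exists2 j, j < 2 * s + 1 & vclass j = o.
    by case: o => [[]|]; [exists 1 | exists 2 | exists 0]; rewrite //; lia.
  by rewrite -(gv (Ordinal hj)) leq_addr.
pose cu b := 2 * compl_sum n s * (2 * s + 3) - ucolor n s b.
pose cv o := 2 * compl_sum n s * (4 * n + 4) - vcolor n s o.
have [] := @ltna_of_classes n s g cu cv n_gt0 s_gt0 (total_labeling_compl f_tot).
- by move=> i; rewrite /cu -(gu i) addKn.
- by move=> j; rewrite /cv -(gv j) addKn.
- move=> b b'; rewrite /cu => E; apply: u_inj.
  by rewrite -(subKn (u_le b)) E subKn.
- move=> o o'; rewrite /cv => E; apply: v_inj.
  by rewrite -(subKn (v_le o)) E subKn.
- move=> b o; rewrite /cu /cv; have := ucolor_lt_vcolor_compl n_gt0 s_gt0 b o le_sn.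
  have := u_le b; have := v_le o.
  by move: (_ * (2 * s + 3)) (_ * (4 * n + 4)) => *; lia.
by exists g.
Qed.

Theorem theorem2p9 (n s : nat) (hn : 1 <= n) (hs : 1 <= s) :
  chi_ltna_is (join_graph (cycle_graph (4 * n + 2)) (cycle_graph (2 * s + 1))) 5.
Proof.
split; last by move=> f; apply: c_tn_join_cycles_ge5; lia.
  have m_gt0 : 0 < 4 * n + 2 by lia.
  have r_gt0 : 0 < 2 * s + 1 by lia.
  by case=> x; [exists (inr (Ordinal r_gt0)) | exists (inl (Ordinal m_gt0))].
exact: exists_labeling_five.
Qed.
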